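(* Let $I=(f)\subset\mathcal O_n=\mathcal O_{\mathbb C^n,0}$ be a principal analytic ideal, generated by a holomorphic germ $f$ that is not a unit, let $B_\delta\subset\mathbb C^n$ be a fixed sufficiently small Euclidean ball centred at the origin, and define, for $\varepsilon>0$, $$V(\varepsilon)=\mathrm{Vol}\{x\in B_\delta:\ |f(x)|<\varepsilon\}.$$ Let $\Lambda(I)=\{\lambda_1<\lambda_2<\cdots\}\subset\widetilde\Lambda_\pi(I)$ be the visible spectrum of $I$ (where $\pi$ is a log resolution of $I$), and let $m_\lambda$ denote the order of the pole of the local zeta function $Z_I(s)$ at $\lambda$. Assume that $V(\varepsilon)$ admits the asymptotic expansion $$V(\varepsilon)\sim\sum_{\lambda\in\Lambda(I)}c_\lambda\,\varepsilon^{2\lambda}|\log\varepsilon|^{m_\lambda-1},\qquad \varepsilon\to0^+,$$ with real coefficients $c_\lambda\neq0$ for $\lambda\in\Lambda(I)$, asymptotic in the Poincaré sense to arbitrary finite order, i.e. for every $N$ the difference between $V(\varepsilon)$ and the partial sum over $\lambda\in\Lambda(I)$ with $\lambda\le N$ is $o\bigl(\varepsilon^{2N}|\log\varepsilon|^{m_N}\bigr)$ as $\varepsilon\to0^+$ (with $m_N=0$ if $N$ is not a pole of $Z_I$). For each $k\ge1$ such that $\lambda_k$ exists put $$R_k(\varepsilon)=V(\varepsilon)-\sum_{j<k}c_{\lambda_j}\varepsilon^{2\lambda_j}|\log\varepsilon|^{m_{\lambda_j}-1}.$$ Then: (i) (Recovery of exponents.) The leading exponent is recovered by $$\lambda_1=\frac12\lim_{\varepsilon\to0^+}\frac{\log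 V(\varepsilon)}{\log\varepsilon},$$ and, recursively, $$\lambda_k=\frac12\lim_{\varepsilon\to0^+}\frac{\log|R_k(\varepsilon)|}{\log\varepsilon}.$$ (ii) (Recovery of multiplicities.) For each recovered exponent $\lambda_k$, the multiplicity $m_{\lambda_k}$ is the unique integer $p\ge1$ for which $$\frac{R_k(\varepsilon)}{\varepsilon^{2\lambda_k}|\log\varepsilon|^{p-1}}$$ converges to a finite nonzero limit as $\varepsilon\to0^+$. (iii) (Recovery of coefficients.) The coefficient $c_{\lambda_k}$ is this finite nonzero limit: $$\frac{R_k(\varepsilon)}{\varepsilon^{2\lambda_k}|\log\varepsilon|^{m_{\lambda_k}-1}}\longrightarrow c_{\lambda_k}\in\mathbb R\setminus\{0\}\qquad(\varepsilon\to0^+).$$ Consequently, the complete visible spectral data $\bigl(\{\lambda:c_\lambda\neq0\},(m_\lambda),(c_\lambda)\bigr)$, i.e. the visible spectrum together with its multiplicities and coefficients, is uniquely determined by the asymptotic expansion of $V(\varepsilon)$.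
   Context: Volumes are taken with respect to the $2n$-dimensional Lebesgue measure $d\mathrm{Vol}$ on $\mathbb C^n\simeq\mathbb R^{2n}$; $\delta$ is fixed and all asymptotics are for $\varepsilon\to0^+$. Local zeta function: $Z_I(s)=\int_{B_\delta}|f(x)|^{-2s}\,d\mathrm{Vol}(x)$, convergent for $0<\mathrm{Re}(s)<\mathrm{lct}(I)$ and understood through its meromorphic continuation to $\mathbb C$. Here $\mathrm{lct}(I)$ is the log canonical threshold, the threshold exponent for local integrability of $|f|^{-2\lambda}$ near the origin. Visible spectrum: $\Lambda(I)$ is the set of actual poles of $Z_I(s)$; equivalently (by the paper's definition) the set of exponents $\lambda$ appearing with nonzero coefficient in the asymptotic expansion of $V(\varepsilon)$. Log resolution of $I$: a proper birational morphism $\pi:Y\to X=(\mathbb C^n,0)$ with $Y$ smooth such that $D_\pi:=\mathrm{Exc}(\pi)\cup\mathrm{Supp}(\pi^{-1}I)$ has simple normal crossings. Writing $\pi^*I=\mathcal O_Y(-\sum_i m_iE_i)$ and $K_{Y/X}=\sum_i k_iE_i$, with $E_i$ ranging over all prime components of $D_\pi$, the extended candidate spectrum is $$\widetilde\Lambda_\pi(I)=\bigcup_{E_i\subset D_\pi}\Bigl\{\frac{k_i+1+j}{m_i}: j=0,1,2,\dots\Bigr\},$$ a locally finite set. *)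

(* Defs.v *)
From HB Require Import structures.
From mathcomp Require Import all_boot all_order all_algebra.
From mathcomp Require Import all_classical all_reals all_analysis.
From mathcomp Require Import complex.

Set Implicit Arguments.
Unset Strict Implicit.
Unset Printing Implicit Defensive.

Import Order.TTheory GRing.Theory Num.Theory numFieldNormedType.Exports.

Local Open Scope classical_set_scope.
Local Open Scope ring_scope.

(* [R[i]] under a name of type [numClosedFieldType]: this is what makes the
   topology, norm and differentiability of MathComp-Analysis available on it. *)
Definition Cplx (R : realType) : numClosedFieldType := R[i].

Definition cplx (R : realType) (x y : R) : Cplx R := (x +i* y)%C.

Definition cofr (R : realType) (x : R) : Cplx R := cplx x 0.

(* The norm of the normed field [Cplx R] takes its values in [Cplx R]; this is
   the same modulus as a real number. *)
Definition cabs (R : realType) (z : Cplx R) : R :=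
  ComplexField.Normc.normc (z : R[i]).

(* r ^ w for r > 0 and w complex. When r = 0 and Re w <> 0 the value is 0. *)
Definition cpow (R : realType) (r : R) (w : Cplx R) : Cplx R :=
  let a := r `^ complex.Re w in
  let t := complex.Im w * ln r in cplx (a * cos t) (a * sin t).

Section LebesgueTuple.
Context (R : realType).

Definition cons_tup (k : nat)
    (p : measurableTypeR R * k.-tuple (measurableTypeR R)) :
    k.+1.-tuple (measurableTypeR R) := [the k.+1.-tuple _ of p.1 :: p.2].

Lemma measurable_cons_tup k : measurable_fun [set: _] (@cons_tup k).
Proof. exact: measurable_cons. Qed.

Section step.
Context (k : nat)
  (mu : {sigma_finite_measure set (k.-tuple (measurableTypeR R)) -> \bar R}).

Definition leb_step : set (k.+1.-tuple (measurableTypeR R)) -> \bar R :=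
  pushforward (lebesgue_measure \x mu)%E (@cons_tup k).

Let leb_step0 : leb_step set0 = 0%E.
Proof. by rewrite /leb_step /pushforward preimage_set0 measure0. Qed.

Let leb_step_ge0 A : (0 <= leb_step A)%E.
Proof. by apply: integral_ge0 => x _; exact: measure_ge0. Qed.

Let leb_step_sigma_additive : semi_sigma_additive leb_step.
Proof.
move=> F mF tF mUF; rewrite /leb_step /pushforward preimage_bigcup.
apply: measure_semi_sigma_additive.
- by move=> i; rewrite -[X in measurable X]setTI; exact: measurable_cons_tup.
- apply/trivIsetP => /= i j _ _ ij; rewrite -preimage_setI.
  by move/trivIsetP : tF => /(_ _ _ _ _ ij) ->//; rewrite preimage_set0.
- by rewrite -preimage_bigcup -[X in measurable X]setTI; exact: measurable_cons_tup.
Qed.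

HB.instance Definition _ := isMeasure.Build _ _ _ leb_step
  leb_step0 leb_step_ge0 leb_step_sigma_additive.

Lemma leb_step_sigma_finite : sigma_finite setT leb_step.
Proof.
have /sigma_finiteP[F [TF ndF Foo]] :=
  sigma_finiteT [the {sigma_finite_measure set _ -> \bar R} of
    @lebesgue_measure R].
have /sigma_finiteP[G [TG ndG Goo]] := sigma_finiteT mu.
pose u (t : k.+1.-tuple (measurableTypeR R)) := (thead t, [tuple of behead t]).
have mu_ : measurable_fun setT u.
  apply: measurable_fun_pair; last exact: measurable_behead.
  exact: measurable_tnth.
have uK (A : set (measurableTypeR R * k.-tuple (measurableTypeR R))) :
    cons_tup (k := k) @^-1` (u @^-1` A) = A.
  rewrite -[in RHS](preimage_id A) -comp_preimage; congr (_ @^-1` A).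
  by apply/funext => -[x t]; congr pair; apply/val_inj.
exists (fun i => u @^-1` (F i `*` G i)).
  rewrite -preimage_bigcup -[LHS](preimage_setT u); congr (u @^-1` _).
  apply/seteqP; split => // -[x t] _.
  have [i _ Fi] : (\bigcup_i F i) x by rewrite -TF.
  have [j _ Gj] : (\bigcup_i G i) t by rewrite -TG.
  exists (maxn i j) => //; split.
    by move: x Fi; exact/subsetPset/ndF/leq_maxl.
  by move: t Gj; exact/subsetPset/ndG/leq_maxr.
move=> i; have [mF Fi] := Foo i; have [mG Gi] := Goo i; split.
  by rewrite -[X in measurable X]setTI; apply: mu_ => //; exact: measurableX.
rewrite /leb_step /pushforward uK product_measure1E//.
by rewrite lte_mul_pinfty// ge0_fin_numE.
Qed.

HB.instance Definition _ :=
  Measure_isSigmaFinite.Build _ _ _ leb_step leb_step_sigma_finite.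
End step.

(* Lebesgue measure on R^k, by iterated products. *)
Fixpoint lebesgue_tuple (k : nat) :
    {sigma_finite_measure set (k.-tuple (measurableTypeR R)) -> \bar R} :=
  match k with
  | 0 => \d_ ([tuple] : 0.-tuple (measurableTypeR R))
  | k'.+1 => leb_step (lebesgue_tuple k')
  end.

End LebesgueTuple.

Section ComplexSpace.
Context (R : realType) (n : nat).
Local Notation C := (Cplx R).
Local Notation E := 'rV[C]_n.

(* C^n as R^(2n): the first n entries are the real parts of the coordinates,
   the last n entries their imaginary parts. *)
Definition of_real_tuple (t : (n + n).-tuple (measurableTypeR R)) : E :=
  \row_i cplx (tnth t (lshift n i)) (tnth t (rshift n i)).

Definition vol (A : set E) : \bar R :=
  lebesgue_tuple R (n + n) (of_real_tuple @^-1` A).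

Definition integrable_on (B : set E) (g : E -> R) : Prop :=
  (lebesgue_tuple R (n + n)).-integrable (of_real_tuple @^-1` B)
    (fun t => (g (of_real_tuple t))%:E).

Definition integral_on (B : set E) (g : E -> R) : R :=
  Rintegral (lebesgue_tuple R (n + n)) (of_real_tuple @^-1` B)
    (g \o of_real_tuple).

Definition euclidean_norm2 (x : E) : R := \sum_i cabs (x 0 i) ^+ 2.

Definition euclidean_ball (r : R) : set E :=
  [set x | euclidean_norm2 x < r ^+ 2].

Definition closed_euclidean_ball (r : R) : set E :=
  [set x | euclidean_norm2 x <= r ^+ 2].

Definition sublevel_volume (f : E -> C) (delta eps : R) : R :=
  fine (vol [set x | euclidean_ball delta x /\ cabs (f x) < eps]).

Definition lct (f : E -> C) : \bar R :=
  ereal_sup [set l%:E | l in [set l : R | 0 <= l /\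
    exists2 r, 0 < r &
      integrable_on (euclidean_ball r) (fun x => cabs (f x) `^ (- (2 * l)))]].

(* The integrand of the local zeta function; it is set to 0 on the zero locus
   of f when Re s <> 0, which does not affect the integral. *)
Definition zeta_integrand (f : E -> C) (s : C) (x : E) : C :=
  cpow (cabs (f x)) (- (2 * s)).

End ComplexSpace.

Section Meromorphic.
Context (R : realType).
Local Notation C := (Cplx R).

(* Complex Frechet differentiability; meant for open U. *)
Definition holomorphic (V W : normedModType C) (U : set V) (g : V -> W) :=
  forall x, U x -> differentiable g x.

Definition meromorphic (Z : C -> C) := forall s0 : C,
  exists (p : nat) (h : C -> C),
    (\forall s \near s0, differentiable h s) /\
    (\forall s \near s0^', Z s = h s / (s - s0) ^+ p).

Definition has_pole_of_order (Z : C -> C) (s0 : C) (p : nat) :=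
  (0 < p)%N /\ exists h : C -> C,
  [/\ \forall s \near s0, differentiable h s, h s0 != 0 &
      \forall s \near s0^', Z s = h s / (s - s0) ^+ p].

Definition is_pole (Z : C -> C) (s0 : C) :=
  exists p, has_pole_of_order Z s0 p.

(* 0 when s0 is not a pole *)
Definition pole_order (Z : C -> C) (s0 : C) : nat :=
  xget 0%N (has_pole_of_order Z s0).

Definition is_local_zeta (n : nat) (f : 'rV[C]_n -> C) (delta : R)
    (Z : C -> C) :=
  meromorphic Z /\
  forall s : C, 0 < complex.Re s -> ((complex.Re s)%:E < lct f)%E ->
    let B := @euclidean_ball R n delta in
    let re x := complex.Re (zeta_integrand f s x) in
    let im x := complex.Im (zeta_integrand f s x) in
    [/\ integrable_on B re, integrable_on B im &
        Z s = cplx (integral_on B re) (integral_on B im)].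

(* The real poles; the inclusion in the candidate spectrum says that there are
   no others. *)
Definition visible_spectrum (Z : C -> C) : set R :=
  [set l | is_pole Z (cofr l)].

Definition pole_multiplicity (Z : C -> C) (l : R) : nat :=
  pole_order Z (cofr l).

End Meromorphic.

Section LogResolution.
Context (R : realType) (n : nat).
Local Notation C := (Cplx R).
Local Notation E := 'rV[C]_n.

(* [cmap] and [cinv] are only meaningful on [cdom] and on its image. *)
Record chart (Y : topologicalType) := Chart {
  cdom : set Y;
  cmap : Y -> E;
  cinv : E -> Y }.

Definition cimg (Y : topologicalType) (c : chart Y) : set E :=
  cmap c @` cdom c.

Definition homeo_chart (Y : topologicalType) (c : chart Y) :=
  [/\ open (cdom c), open (cimg c),
      forall y, cdom c y -> cinv c (cmap c y) = y,
      forall y, cdom c y -> {for y, continuous (cmap c)} &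
      forall x, cimg c x -> {for x, continuous (cinv c)}].

Definition holo_transition (Y : topologicalType) (c d : chart Y) :=
  holomorphic (cmap c @` (cdom c `&` cdom d)) (cmap d \o cinv c).

Record complex_manifold := ComplexManifold {
  carrier :> topologicalType;
  atlas : set (chart carrier);
  atlas_homeo : forall c, atlas c -> homeo_chart c;
  atlas_cover : forall y, exists2 c, atlas c & cdom c y;
  atlas_holo : forall c d, atlas c -> atlas d -> holo_transition c d;
  carrier_hausdorff : hausdorff_space carrier;
  carrier_second_countable : @second_countable carrier }.

Definition holo_chart (Y : complex_manifold) (c : chart Y) :=
  homeo_chart c /\
  forall d, atlas d -> holo_transition c d /\ holo_transition d c.

Definition holo_from (Y : complex_manifold) (V : normedModType C)
    (g : Y -> V) :=
  forall c : chart Y, atlas c -> holomorphic (cimg c) (g \o cinv c).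

Definition holo_into (Y : complex_manifold) (U : set E) (g : E -> Y) :=
  forall x, U x -> {for x, continuous g} /\
    forall c : chart Y, atlas c -> cdom c (g x) ->
      differentiable (cmap c \o g) x.

Definition analytic_subset (W S : set E) :=
  S `<=` W /\
  forall x, W x -> exists (k : nat) (N : set E) (h : E -> 'rV[C]_k),
    [/\ open N, N x, N `<=` W, holomorphic N h &
        forall y, N y -> S y <-> h y = 0].

Definition local_biholomorphism_at (Y : complex_manifold) (pi : Y -> E)
    (y : Y) :=
  exists (N : set Y) (g : E -> Y),
    [/\ open N, N y, open (pi @` N), forall z, N z -> g (pi z) = z &
        holo_into (pi @` N) g].

Definition exceptional_locus (Y : complex_manifold) (pi : Y -> E) : set Y :=
  ~` [set y | local_biholomorphism_at pi y].

(* A proper bimeromorphic holomorphic map Y -> W: biholomorphic over the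
   complement of a nowhere dense analytic subset S of W whose preimage is
   nowhere dense. *)
Definition proper_modification (Y : complex_manifold) (W : set E)
    (pi : Y -> E) :=
  [/\ forall y, W (pi y),
      holo_from pi,
      forall K, compact K -> K `<=` W -> compact (pi @^-1` K) &
      exists (S : set E) (g : E -> Y),
        [/\ analytic_subset W S, interior S = set0, interior (pi @^-1` S) = set0,
            forall x, W x -> ~ S x -> pi (g x) = x &
            (forall y, ~ S (pi y) -> g (pi y) = y) /\
            holo_into (W `\` S) g]].

Section Divisors.
Context (Y : complex_manifold) (I : finType) (D : I -> set Y).

(* Holomorphic coordinates around p in which each D i is either a coordinate
   hyperplane, the [s i]-th one, if it contains p, or empty. *)
Definition snc_chart_at (p : Y) (c : chart Y) (s : I -> 'I_n) :=
  [/\ holo_chart c, cdom c p,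
      forall i j, D i p -> D j p -> s i = s j -> i = j &
      forall i y, cdom c y -> D i y <-> D i p /\ cmap c y 0 (s i) = 0].

(* In these coordinates, div F = \sum_i (mult i) D i. *)
Definition has_divisor_in_chart (mult : I -> nat) (p : Y) (c : chart Y)
    (s : I -> 'I_n) (F : E -> C) :=
  exists u : E -> C,
    [/\ holomorphic (cimg c) u, forall x, cimg c x -> u x != 0 &
        forall x, cimg c x ->
          F x = u x * \prod_(i | `[< D i p >]) x 0 (s i) ^+ mult i].

End Divisors.

(* A log resolution of the ideal (f) over an open neighbourhood W of 0 that
   represents the germ (C^n, 0). The components of the simple normal crossings
   divisor D_pi are finite in number; being smooth (by the choice of charts) and
   connected they are irreducible. [lr_m] gives the divisor of pi^* f, and
   [lr_k] that of the Jacobian determinant of pi, i.e. K_{Y/X}. *)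
Record log_resolution (W : set E) (f : E -> C) := LogResolution {
  lr_space : complex_manifold;
  lr_map : lr_space -> E;
  lr_proper : proper_modification W lr_map;
  lr_index : finType;
  lr_component : lr_index -> set lr_space;
  lr_m : lr_index -> nat;
  lr_k : lr_index -> nat;
  lr_component_irreducible : forall i,
    [/\ lr_component i !=set0, closed (lr_component i) &
        connected (lr_component i)];
  lr_divisor :
    \bigcup_i lr_component i =
    exceptional_locus lr_map `|` [set y | f (lr_map y) = 0];
  lr_snc : forall p, exists (c : chart lr_space) (s : lr_index -> 'I_n),
    [/\ snc_chart_at lr_component p c s,
        has_divisor_in_chart lr_component lr_m p c s
          (f \o lr_map \o cinv c) &
        has_divisor_in_chart lr_component lr_k p c s
          (fun x => \det ('J (lr_map \o cinv c) x))] }.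

(* Components with m_i = 0 (exceptional but not in the support of f) have
   (k_i + 1 + j) / m_i = +oo and give no candidate. *)
Definition candidate_spectrum (W : set E) (f : E -> C)
    (X : log_resolution W f) : set R :=
  [set l | exists (i : lr_index X) (j : nat),
    (0 < lr_m i)%N /\ l = (lr_k i + 1 + j)%:R / (lr_m i)%:R].

End LogResolution.

Section Expansion.
Context (R : realType).
Local Notation right0 := ((0 : R)^'+).

(* An expansion is given by its set L of exponents, the multiplicities m
   (equal to 0 outside L) and the coefficients c (irrelevant outside L). *)
Definition expansion_term (m : R -> nat) (c : R -> R) (l e : R) : R :=
  c l * e `^ (2 * l) * `|ln e| ^+ (m l).-1.

(* The sum is over a finite set as soon as L is locally finite and bounded
   below. *)
Definition has_expansion (V : R -> R) (L : set R) (m : R -> nat)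
    (c : R -> R) :=
  forall N : R,
    (fun e => V e - \sum_(l \in [set l | L l /\ l <= N]) expansion_term m c l e)
      =o_right0 (fun e => e `^ (2 * N) * `|ln e| ^+ m N).

Definition spectral_data (L : set R) (m : R -> nat) (c : R -> R) :=
  [/\ forall N, finite_set [set l | L l /\ l <= N],
      forall l, L l <-> (0 < m l)%N &
      forall l, L l -> c l != 0].

Definition same_expansion (V V' : R -> R) :=
  forall N : R, (fun e => V e - V' e) =o_right0 (fun e => e `^ N).

(* x is the k-th element, counted from k = 1, of L in increasing order. *)
Definition is_exponent (L : set R) (k : nat) (x : R) :=
  [/\ (0 < k)%N, L x & ([set y | L y /\ y < x] #= `I_k.-1)%card].

Definition exponent (L : set R) (k : nat) : R := xget 0 (is_exponent L k).

Definition remainder (V : R -> R) (L : set R) (m : R -> nat) (c : R -> R)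
    (k : nat) (e : R) : R :=
  V e - \sum_(1 <= j < k) expansion_term m c (exponent L j) e.

End Expansion.

(* Main.v *)
Require Import Defs.
From HB Require Import structures.
From mathcomp Require Import all_boot all_order all_algebra.
From mathcomp Require Import all_classical all_reals all_analysis.
From mathcomp Require Import complex.
Import Order.TTheory GRing.Theory Num.Theory numFieldNormedType.Exports.
Local Open Scope classical_set_scope.
Local Open Scope ring_scope.

(** The exponents form a set L that is locally finite on the left: only
    finitely many of them lie below a given real, because they belong to a
    finite union of arithmetic progressions. So for an exponent l there is some
    N > l with no exponent in ]l, N], and the expansion truncated at N says that
      V(e) - sum_(y < l) term_y(e) = term_l(e) + o(e^(2N)).
    The gap matters: truncating at l itself would leave an error
    o(e^(2l) |log e|^(m_l)), which can exceed term_l, of size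
    e^(2l) |log e|^(m_l - 1). As N > l, the error is o(e^(2l)), hence negligible
    whatever the power of |log e| ([tail_asymp], [tail_cvg]), and
      R_k(e) / (e^(2l) |log e|^(m_l - 1)) --> c_l <> 0    for l = lambda_k.
    This is the recovery of the coefficient. Two different powers of |log e|
    cannot both scale the same function to a finite nonzero limit
    ([cvg_scale_order_unique]), which gives the multiplicity; taking logarithms,
    log |R_k(e)| = 2 l log e + (m_l - 1) log |log e| + O(1), and dividing by
    log e gives the exponent ([cvg_ln_ratio]).

    Two expansions of the same function agree by induction on the exponent:
    if they agree strictly below l, they have the same remainder at l, whose
    behaviour tells whether l occurs, and with which multiplicity and
    coefficient ([expansion_unique]).

    That a first exponent exists needs geometry. Since f(0) = 0 and f is
    differentiable at 0, |f(x)| <= k |x| near 0, so the sublevel set at e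
    contains a cube of side proportional to e, and V(e) >= kappa e^(2n)
    ([sublevel_volume_ge]). With no exponent at all, the expansion would give
    V(e) = o(e^(2n+2)). *)

Set Implicit Arguments.
Unset Strict Implicit.
Unset Printing Implicit Defensive.

(** * Subsets of the line that are locally finite on the left *)

Lemma finite_set_has_min d (T : orderType d) (A : set T) :
  finite_set A -> A !=set0 -> exists2 x, A x & forall y, A y -> (x <= y)%O.
Proof.
move=> /finite_setP[k]; elim: k A => [|k IH] A.
  by rewrite II0 card_eq0 => /eqP -> [? []].
move=> /eq_cardSP[x Ax Ak] _.
have [A0|/set0P A0] := eqVneq (A `\ x) set0; last have [z [Az zx] zmin] := IH _ Ak A0.
  exists x => // y Ay; have [->//|/eqP yx] := eqVneq y x.
  by have : (A `\ x) y by []; rewrite A0.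
exists (Order.min x z) => [|y Ay]; first by rewrite /Order.min; case: ifP.
rewrite ge_min; have [->|/eqP yx] := eqVneq y x; first by rewrite lexx.
by rewrite zmin ?orbT.
Qed.

Section LocallyFinite.
Context (R : realType).
Implicit Types (L : set R) (F : R -> R).

(** Only finitely many elements up to any bound: such a set can be listed in
    increasing order. *)
Definition locally_finite_left L := forall N, finite_set [set l | L l /\ l <= N].

(** The elements of L strictly smaller than x. *)
Definition below L x : set R := [set y | L y /\ y < x].

Lemma finite_below L x : locally_finite_left L -> finite_set (below L x).
Proof.
by move=> /(_ x); apply: sub_finite_set => y [Ly /ltW yx]; split.
Qed.

(** The predecessor y of x in L: the elements below x are y and those
    below y. *)
Lemma below_max L x : locally_finite_left L -> below L x !=set0 ->
  exists2 y, below L x y & below L x `\ y = below L y.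
Proof.
move=> fL B0.
have [y By ymax] := @finite_set_has_min _ R^d _ (finite_below x fL) B0.
exists y => //; apply/seteqP; split => z [] => [[Lz zx] zy|Lz zy].
  split=> //; rewrite lt_neqAle; apply/andP; split; first exact/eqP.
  exact: (ymax z).
split; first by split=> //; exact: lt_trans zy By.2.
by move=> zey; rewrite zey ltxx in zy.
Qed.

(** Well-founded induction along the elements of L, on the number of elements
    of L below x. *)
Lemma locally_finite_left_ind L (P : R -> Prop) : locally_finite_left L ->
  (forall x, (forall y, L y -> y < x -> P y) -> P x) -> forall x, P x.
Proof.
move=> fL IH x; have /finite_setP[k] := finite_below x fL.
elim/ltn_ind: k x => k IHk x Bk; apply: IH => y Ly yx.
have /finite_setP[j Bj] := finite_below y fL.
apply: (IHk j) => //; rewrite -card_le_II -(card_le_eqr Bk).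
apply: (@card_le_trans _ _ _ (y |` below L y)); last first.
  by apply: subset_card_le => z [->//|[Lz zy]]; split=> //; exact: lt_trans zy yx.
have -> : (`I_j.+1 #<= y |` below L y)%card = (`I_j.+1 #<= `I_j.+1)%card; last by [].
apply: card_le_eqr; apply/eq_cardSP; exists y; first by left.
rewrite setDUl setDv set0U not_setD1 // => -[_]; by rewrite ltxx.
Qed.

(** L has no element just above x. *)
Lemma locally_finite_gap L x : locally_finite_left L ->
  exists2 y, x < y & forall z, L z -> z <= y -> z <= x.
Proof.
move=> fL; pose A := [set z | L z /\ x < z <= x + 1].
have fA : finite_set A.
  by apply: sub_finite_set (fL (x + 1)) => z [Lz /andP[_ ?]]; split.
have [A0|/set0P A0] := eqVneq A set0; last first.
  have [z [Lz /andP[xz z1]] zmin] := finite_set_has_min fA A0.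
  exists ((x + z) / 2); first by rewrite midf_lt.
  move=> w Lw wle; rewrite leNgt; apply/negP => xw.
  have wz : w < z by rewrite (le_lt_trans wle)// midf_lt.
  have : z <= w by apply: zmin; split=> //; rewrite xw (ltW (lt_le_trans wz z1)).
  by rewrite leNgt wz.
exists (x + 1); first by rewrite ltrDl.
move=> z Lz z1; rewrite leNgt; apply/negP => xz.
by have : A z; [rewrite /A /= xz|rewrite A0].
Qed.

(** At most one element of L has rank k: if x < y, then below y there is one
    more element than below x. *)
Lemma is_exponent_inj L k x y : is_exponent L k x -> is_exponent L k y -> x = y.
Proof.
wlog : x y / x <= y => [H hx hy|xy [_ Lx Bx] [_ Ly By]].
  by have [xy|/ltW yx] := leP x y; [exact: H|apply/esym; exact: H].
apply/eqP; rewrite eq_le xy /= leNgt; apply/negP => {}xy.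
have : (`I_k.-1.+1 #<= `I_k.-1)%card; last by rewrite card_le_II ltnn.
rewrite -(card_le_eqr By).
apply: (@card_le_trans _ _ _ (x |` below L x)); last first.
  by apply: subset_card_le => z [->//|[Lz zx]]; split=> //; exact: lt_trans zx xy.
have -> : (`I_k.-1.+1 #<= x |` below L x)%card = (`I_k.-1.+1 #<= `I_k.-1.+1)%card;
  last by [].
apply: card_le_eqr; apply/eq_cardSP; exists x; first by left.
rewrite setDUl setDv set0U not_setD1 // => -[_]; by rewrite ltxx.
Qed.

Lemma exponentE L k x : is_exponent L k x -> exponent L k = x.
Proof.
by move=> kx; apply: (@is_exponent_inj L k) => //; exact: (xgetPex 0 (ex_intro _ x kx)).
Qed.

Lemma is_exponent_exponent L k : (exists x, is_exponent L k x) ->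
  is_exponent L k (exponent L k).
Proof. by case=> x kx; rewrite (exponentE kx). Qed.

Lemma is_exponent1 L : locally_finite_left L -> L !=set0 ->
  exists x, is_exponent L 1 x.
Proof.
move=> fL [a La].
have [|x [Lx xa] xmin] := finite_set_has_min (fL a); first by exists a; split.
exists x; split=> //; rewrite II0 card_eq0; apply/eqP/seteqP; split => // y [Ly yx].
have : x <= y by apply: xmin; split=> //; exact: le_trans (ltW yx) xa.
by rewrite leNgt yx.
Qed.

(** The first k - 1 elements of L are exactly those below the k-th one. *)
Lemma sum_exponent_below L F k x : locally_finite_left L -> is_exponent L k x ->
  \sum_(1 <= j < k) F (exponent L j) = \sum_(l \in below L x) F l.
Proof.
move=> fL; case: k => [[]//|k]; elim: k x => [|k IH] x [_ Lx] /=.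
  by rewrite II0 card_eq0 => /eqP B0; rewrite big_geq// /below B0 fsbig_set0.
move=> Bk; have [z Bz _] := @eq_cardSP _ _ _ Bk.
have [y By Bxy] := below_max fL (ex_intro _ z Bz).
have ky : is_exponent L k.+1 y.
  split=> //; first exact: By.1.
  rewrite -[X in (X #= _)%card]/(below L y) -Bxy.
  have fD : finite_set (below L x `\ y) by apply: finite_setD; exact: finite_below.
  have /finite_setP[j Dj] := fD.
  have : (below L x #= `I_j.+1)%card by apply/eq_cardSP; exists y.
  by rewrite (card_eql Bk) => /card_eq_II [->].
rewrite big_nat_recr//= (exponentE ky) (IH _ ky) -Bxy addrC.
by rewrite [RHS](fsbigD1 y)//; exact: finite_below.
Qed.

End LocallyFinite.

(** * Logarithmic scales at the right of 0 *)

Section Asymptotics.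
Context (R : realType).
Implicit Types (V r g : R -> R) (L : set R) (m : R -> nat) (c : R -> R).

Lemma near_absln_ge (M : R) : \forall e \near (0 : R)^'+, M <= `|ln e|.
Proof.
have /cvgrNyPle/(_ (- M)) := lnNy (R := R).
by apply: filterS => e; rewrite lerNr => /le_trans; apply; rewrite -normrN ler_norm.
Qed.

Lemma near_right0_lt1 : \forall e \near (0 : R)^'+, 0 < e < 1.
Proof.
near=> e; apply/andP; split; near: e; [exact: nbhs_right_gt|exact: nbhs_right_lt].
Unshelve. all: end_near. Qed.

Lemma cvg_lnV : (ln e)^-1 @[e --> (0 : R)^'+] --> (0 : R).
Proof.
apply/cvgr0Pnorm_le => eps eps0.
near=> e.
have Te : eps^-1 <= `|ln e| by near: e; exact: near_absln_ge.
by rewrite normfV -[leRHS]invrK lef_pV2// posrE ?invr_gt0// (lt_le_trans _ Te)// invr_gt0.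
Unshelve. all: end_near. Qed.

Lemma cvg_absln_exprV k : (0 < k)%N ->
  (`|ln e| ^+ k)^-1 @[e --> (0 : R)^'+] --> (0 : R).
Proof.
move=> k0; have T0 : `|(ln e)^-1| @[e --> (0 : R)^'+] --> (0 : R).
  by have /cvg_norm := cvg_lnV; rewrite normr0.
have /(cvg_comp _ _ T0) := @exprn_continuous R k 0.
rewrite expr0n -leqn0 leqNgt k0 /=; apply: cvg_trans; apply: near_eq_cvg.
by near=> e; rewrite /= normfV exprVn.
Unshelve. all: end_near. Qed.

(** With T = |ln e|, the bound ln T = 2 ln (sqrt T) <= 2 sqrt T suffices. *)
Lemma cvg_lnln_ln : ln `|ln e| / ln e @[e --> (0 : R)^'+] --> (0 : R).
Proof.
apply/cvgr0Pnorm_le => eps eps0; near=> e.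
have T1 : 1 <= `|ln e| by near: e; exact: near_absln_ge.
have T0 : 0 < `|ln e| by exact: lt_le_trans T1.
have Te : (2 / eps) ^+ 2 <= `|ln e| by near: e; exact: near_absln_ge.
set t := Num.sqrt `|ln e|.
have t0 : 0 < t by rewrite sqrtr_gt0.
have tt : t ^+ 2 = `|ln e| by rewrite sqr_sqrtr.
have et : 2 <= eps * t.
  rewrite mulrC -ler_pdivrMr// -(@ler_pXn2r _ 2)// ?tt// nnegrE ?divr_ge0// ltW//.
rewrite normrM normfV (ger0_norm (ln_ge0 _))// ler_pdivrMr// -tt lnXn//.
rewrite (@le_trans _ _ (t *+ 2))//; first by rewrite lerMn2r ltW ?ln_sublinear.
by rewrite expr2 mulrA -mulr_natl ler_pM2r.
Unshelve. all: end_near. Qed.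

(** If g / |ln e|^i converges, then g is negligible with respect to any larger
    power |ln e|^j. *)
Lemma cvg_scale_lt g i j (a b : R) : (i < j)%N ->
  g e / `|ln e| ^+ i @[e --> 0^'+] --> a ->
  g e / `|ln e| ^+ j @[e --> 0^'+] --> b -> b = 0.
Proof.
move=> ij ga gb.
have g0 : g e / `|ln e| ^+ i * (`|ln e| ^+ (j - i))^-1 @[e --> 0^'+] --> a * 0.
  by apply: (cvgM ga); apply: cvg_absln_exprV; rewrite subn_gt0.
rewrite mulr0 in g0.
apply: (cvg_unique _ gb); first exact: Rhausdorff.
apply: cvg_trans g0; apply: near_eq_cvg; near=> e => /=.
have T1 : 1 <= `|ln e| by near: e; exact: near_absln_ge.
rewrite /= -mulrA -invfM -exprD subnKC ?(ltnW ij)//.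
Unshelve. all: end_near. Qed.

(** If r is equivalent to a e^x |ln e|^k with a nonzero, then ln |r| / ln e
    converges to x, whatever k is. *)
Lemma cvg_ln_ratio r x k (a : R) : a != 0 ->
  r e / (e `^ x * `|ln e| ^+ k) @[e --> 0^'+] --> a ->
  ln `|r e| / ln e @[e --> 0^'+] --> x.
Proof.
move=> a0 ra; set h := (fun e => r e / _) in ra.
have lnh : ln `|h e| @[e --> 0^'+] --> ln `|a|.
  have := cvg_comp _ _ (cvg_norm ra) (@continuous_ln R `|a| _).
  by rewrite normr_gt0; exact.
have : ln `|h e| * (ln e)^-1 + (x + k%:R * (ln `|ln e| / ln e))
    @[e --> 0^'+] --> ln `|a| * 0 + (x + k%:R * 0).
  apply: cvgD; first by apply: cvgM => //; exact: cvg_lnV.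
  apply: cvgD; first exact: cvg_cst.
  by apply: cvgM; [exact: cvg_cst|exact: cvg_lnln_ln].
rewrite !mulr0 add0r addr0; apply: cvg_trans; apply: near_eq_cvg; near=> e => /=.
have /andP[e0 e1] : 0 < e < 1 by near: e; exact: near_right0_lt1.
have T1 : 1 <= `|ln e| by near: e; exact: near_absln_ge.
have T0 : 0 < `|ln e| by exact: lt_le_trans T1.
have h0 : 0 < `|h e|.
  rewrite normr_gt0; near: e.
  exact: (cvgr_neq0 _ ra a0).
have -> : `|r e| = `|h e| * (e `^ x * `|ln e| ^+ k).
  rewrite /h normrM normfV [X in _ / X]ger0_norm ?mulr_ge0 ?powR_ge0// mulfVK//.
  by rewrite mulf_neq0 ?expf_neq0// gt_eqF// powR_gt0.
rewrite !lnM ?posrE ?mulr_gt0 ?powR_gt0 ?exprn_gt0// ln_powR lnXn//.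
by rewrite !mulrDl mulfK -?normr_gt0// -[in RHS]mulr_natl mulrA.
Unshelve. all: end_near. Qed.

End Asymptotics.

(** * The first term that has not been subtracted *)

Section Expansion.
Context (R : realType) (V : R -> R) (L : set R) (m : R -> nat) (c : R -> R).
Context (fL : locally_finite_left L) (mL : forall l, L l <-> (0 < m l)%N).
Context (VL : has_expansion V L m c).

(** What remains of V once the terms of exponent smaller than l are subtracted;
    l is any real number, not necessarily an exponent. *)
Definition tail l e : R := V e - \sum_(y \in below L l) expansion_term m c y e.

(** The expansion is used at a bound y > l without exponent in ]l, y]. Then
    m y = 0, and the error o(e^(2 y)) carries no logarithm. *)
Lemma tail_asymp l :
  (tail l e - (if `[< L l >] then expansion_term m c l e else 0)) / e `^ (2 * l)
    @[e --> 0^'+] --> (0 : R).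
Proof.
have [y ly yL] := locally_finite_gap l fL.
have my : m y = 0%N.
  by apply/eqP; rewrite -leqn0 leqNgt; apply/negP => /mL/yL/(_ (lexx y)); rewrite leNgt ly.
(* The exponents up to y are those below l, and l itself if it is one. *)
have sumE e : V e - \sum_(z \in [set z | L z /\ z <= y]) expansion_term m c z e =
    tail l e - (if `[< L l >] then expansion_term m c l e else 0).
  rewrite /tail -addrA -opprD; congr (_ - _); case: asboolP => Ll.
    rewrite (fsbigD1 l)/=; [|exact: fL|by split=> //; exact: ltW].
    rewrite addrC; congr (_ + _); apply: eq_fsbigl; apply/seteqP; split => z /=.
      move=> [[Lz zy] zl]; split=> //; rewrite lt_neqAle yL// andbT; exact/eqP.
    move=> [Lz zl]; split; first by split=> //; exact: ltW (lt_trans zl ly).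
    by move=> zel; rewrite zel ltxx in zl.
  rewrite addr0; apply: eq_fsbigl; apply/seteqP; split => z /= [Lz zy]; split=> //.
    by rewrite lt_neqAle yL// andbT; apply/eqP => zl; rewrite -zl in Ll.
  exact: ltW (lt_trans zy ly).
have /eqoP Vy := VL y.
apply/cvgr0Pnorm_le => eps eps0.
near=> e.
have /andP[e0 e1] : 0 < e < 1 by near: e; exact: near_right0_lt1.
have : `|V e - \sum_(z \in [set z | L z /\ z <= y]) expansion_term m c z e| <=
  eps * `|e `^ (2 * y) * `|ln e| ^+ m y| by near: e; exact: Vy.
rewrite sumE [m y]my expr0 mulr1 => H.
rewrite normrM normfV !(ger0_norm (powR_ge0 _ _)) ler_pdivrMr ?powR_gt0//.
rewrite (le_trans H)// ger0_norm ?powR_ge0// ler_pM2l//.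
by apply: ger_powR; [rewrite e0 ltW|rewrite ler_pM2l// ltW].
Unshelve. all: end_near. Qed.

Lemma tail_cvg l : L l ->
  tail l e / (e `^ (2 * l) * `|ln e| ^+ (m l).-1) @[e --> 0^'+] --> c l.
Proof.
move=> Ll; have := tail_asymp l; rewrite asboolT// => /cvgr0Pnorm_le h.
apply/cvgrPdist_le => eps eps0; near=> e.
have /andP[e0 e1] : 0 < e < 1 by near: e; exact: near_right0_lt1.
have T1 : 1 <= `|ln e| by near: e; exact: near_absln_ge.
have : `|(tail l e - expansion_term m c l e) / e `^ (2 * l)| <= eps.
  by near: e; exact: h.
set k := (m l).-1.
have Tk : 1 <= `|ln e| ^+ k by rewrite exprn_ege1.
have Tk0 : 0 < `|ln e| ^+ k by exact: lt_le_trans Tk.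
have p0 : 0 < e `^ (2 * l) by exact: powR_gt0.
rewrite distrC.
have -> : tail l e / (e `^ (2 * l) * `|ln e| ^+ k) - c l =
  (tail l e - expansion_term m c l e) / e `^ (2 * l) / `|ln e| ^+ k.
  rewrite invfM; move: (tail _ _) => t; rewrite !mulrBl mulrA; congr (_ - _).
  by rewrite /expansion_term -/k [_ * _ / e `^ _]mulrAC mulfK ?gt_eqF// mulfK// gt_eqF.
move: (_ / e `^ (2 * l)) => q He; rewrite normrM normfV [X in _ / X]ger0_norm ?(ltW Tk0)// ler_pdivrMr//.
by rewrite (le_trans He)// ler_peMr// ltW.
Unshelve. all: end_near. Qed.

(** At a real l that is not an exponent, the remainder is o(e^(2 l)), and a
    fortiori negligible against any power of |ln e|. *)
Lemma tail_cvg0 l k : ~ L l ->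
  tail l e / (e `^ (2 * l) * `|ln e| ^+ k) @[e --> 0^'+] --> (0 : R).
Proof.
move=> Ll; have := tail_asymp l; rewrite asboolF// => /cvgr0Pnorm_le h.
apply/cvgr0Pnorm_le => eps eps0; near=> e.
have T1 : 1 <= `|ln e| by near: e; exact: near_absln_ge.
have He : `|(tail l e - 0) / e `^ (2 * l)| <= eps by near: e; exact: h.
have Tk : 1 <= `|ln e| ^+ k by rewrite exprn_ege1.
rewrite invfM mulrA normrM normfV [X in _ / X]ger0_norm; last exact: le_trans Tk.
rewrite ler_pdivrMr; last exact: lt_le_trans Tk.
by rewrite subr0 in He; rewrite (le_trans He)// ler_peMr// ltW.
Unshelve. all: end_near. Qed.

End Expansion.

(** * Uniqueness of the expansion *)

Section Recovery.
Context (R : realType).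
Implicit Types (V : R -> R) (L : set R) (m : R -> nat) (c : R -> R).

(** The remainder indexed by the rank k is the one indexed by the k-th
    exponent. *)
Lemma remainderE V L m c k x e : locally_finite_left L -> is_exponent L k x ->
  remainder V L m c k e = tail V L m c x e.
Proof.
move=> fL kx; congr (_ - _).
exact: (sum_exponent_below (fun l => expansion_term m c l e) fL kx).
Qed.

Lemma same_expansion_has_expansion V V' L m c :
  same_expansion V' V -> has_expansion V' L m c -> has_expansion V L m c.
Proof.
move=> VV' V'L N; apply/eqoP => eps eps0.
have eps20 : 0 < eps / 2 by rewrite divr_gt0.
have /eqoP/(_ _ eps20) h1 := V'L N.
have /eqoP/(_ _ eps20) h2 := VV' (2 * N).
near=> e.
have T1 : 1 <= `|ln e| by near: e; exact: near_absln_ge.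
have H1 : `|V' e - \sum_(l \in [set l | L l /\ l <= N]) expansion_term m c l e| <=
  eps / 2 * `|e `^ (2 * N) * `|ln e| ^+ m N| by near: e; exact: h1.
have H2 : `|V' e - V e| <= eps / 2 * `|e `^ (2 * N)| by near: e; exact: h2.
have h3 : `|e `^ (2 * N)| <= `|e `^ (2 * N) * `|ln e| ^+ m N|.
  by rewrite normrM ler_peMr// normrX normr_id exprn_ege1.
set S := \sum_(_ \in _) _ in H1 *.
have -> : V e - S = (V' e - S) - (V' e - V e) by rewrite opprB [RHS]addrC addrA subrK.
rewrite (le_trans (ler_normB _ _))// [X in X * _]splitr mulrDl lerD//.
by rewrite (le_trans H2)// ler_pM2l.
Unshelve. all: end_near. Qed.

(** The power of |ln e| in a leading term is determined by the function. *)
Lemma cvg_scale_order_unique (r : R -> R) x i j (a b : R) : a != 0 -> b != 0 ->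
  r e / (e `^ x * `|ln e| ^+ i) @[e --> 0^'+] --> a ->
  r e / (e `^ x * `|ln e| ^+ j) @[e --> 0^'+] --> b -> i = j.
Proof.
move=> a0 b0; have rE k : (fun e => r e / (e `^ x * `|ln e| ^+ k)) =
    (fun e => (r e / e `^ x) / `|ln e| ^+ k).
  by apply/funext => e; rewrite invfM mulrA.
rewrite !rE => ra rb; have [ij|ji|//] := ltngtP i j.
  by have /eqP := b0; case; exact: cvg_scale_lt ij ra rb.
by have /eqP := a0; case; exact: cvg_scale_lt ji rb ra.
Qed.

(** By induction on l, through the common remainder at l: it is of order
    e^(2 l) |ln e|^(m l - 1) if l is an exponent and o(e^(2 l)) otherwise. *)
Lemma expansion_unique V L m c L' m' c' :
  spectral_data L m c -> spectral_data L' m' c' ->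
  has_expansion V L m c -> has_expansion V L' m' c' ->
  forall l, [/\ L l <-> L' l, m l = m' l & L l -> c l = c' l].
Proof.
move=> [fL mL c0] [fL' mL' c0'] VL VL'.
have fLL' : locally_finite_left (L `|` L').
  move=> N; have : finite_set ([set l | L l /\ l <= N] `|` [set l | L' l /\ l <= N]).
    by rewrite finite_setU; split.
  by apply: sub_finite_set => l [[Ll|Ll] lN]; [left|right].
apply: (locally_finite_left_ind fLL') => x IH.
have same_tail e : tail V L m c x e = tail V L' m' c' x e.
  congr (_ - _); rewrite (_ : below L' x = below L x).
    apply: eq_fsbigr => y; rewrite inE => -[Ly yx].
    have [_ my cy] := IH y (or_introl Ly) yx.
    by rewrite /expansion_term my cy.
  apply/seteqP; split => y [Ly yx]; split=> //.
    by have [[_ h] _ _] := IH y (or_intror Ly) yx; exact: h.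
  by have [[h _] _ _] := IH y (or_introl Ly) yx; exact: h.
have tE k : (fun e => tail V L m c x e / (e `^ (2 * x) * `|ln e| ^+ k)) =
    (fun e => tail V L' m' c' x e / (e `^ (2 * x) * `|ln e| ^+ k)).
  by apply/funext => e; rewrite same_tail.
have [Lx|Lx] := pselect (L x); have [Lx'|Lx'] := pselect (L' x).
- have t1 := tail_cvg fL mL VL Lx; have t2 := tail_cvg fL' mL' VL' Lx'.
  have mx : m x = m' x.
    have m0 : (0 < m x)%N by exact/mL.
    have m0' : (0 < m' x)%N by exact/mL'.
    rewrite -(prednK m0) -(prednK m0'); congr _.+1.
    rewrite -tE in t2.
    exact: cvg_scale_order_unique (c0 _ Lx) (c0' _ Lx') t1 t2.
  split=> // _; rewrite tE mx in t1.
  exact: (cvg_unique _ t1 t2).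
- have t1 := tail_cvg fL mL VL Lx; rewrite tE in t1.
  have t2 := tail_cvg0 fL' mL' VL' (m x).-1 Lx'.
  by have /eqP := c0 _ Lx; case; exact: (cvg_unique _ t1 t2).
- have t1 := tail_cvg fL' mL' VL' Lx'; rewrite -tE in t1.
  have t2 := tail_cvg0 fL mL VL (m' x).-1 Lx.
  by have /eqP := c0' _ Lx'; case; exact: (cvg_unique _ t1 t2).
split=> //; have := mL x; have := mL' x.
by case: (m x) (m' x) => [|?] [|?] // [_ h'] [_ h]; [have := h' isT|have := h isT|have := h isT].
Qed.

End Recovery.

(** * Volumes of cubes *)

Section Volume.
Context (R : realType).

(** No measurability is needed, as the integral of a nonnegative function is
    the supremum of the integrals of the simple functions below it. *)
Lemma le_ge0_integral d (T : measurableType d) (mu : {measure set T -> \bar R})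
    (f g : T -> \bar R) : (forall x, 0 <= f x)%E -> (forall x, f x <= g x)%E ->
  (\int[mu]_x f x <= \int[mu]_x g x)%E.
Proof.
move=> f0 fg; rewrite !ge0_integralTE//; last first.
  by move=> x; exact: le_trans (fg x).
apply: le_ereal_sup => _ [h hf <-]; exists h => // x.
exact: le_trans (hf x) (fg x).
Qed.

(** Monotonicity on arbitrary sets: sublevel sets can thus be compared with
    cubes without proving that they are measurable. *)
Lemma le_lebesgue_tuple k (A B : set (k.-tuple (measurableTypeR R))) :
  A `<=` B -> (lebesgue_tuple R k A <= lebesgue_tuple R k B)%E.
Proof.
elim: k A B => [|k IH] A B AB /=.
  rewrite /dirac /= lee_fin !indicE ler_nat.
  have [/set_mem/AB/mem_set ->//|//] := boolP ([tuple] \in A).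
apply: le_ge0_integral => x; first exact: measure_ge0.
by apply: IH => t; rewrite /xsection /= !inE; exact: AB.
Qed.

(** The closed cube of side 2 r centred at the origin of R^k. *)
Definition cube k (r : R) : set (k.-tuple (measurableTypeR R)) :=
  [set t | forall i, `|tnth t i| <= r].
Arguments cube : clear implicits.

Lemma measurable_cube k r : measurable (cube k r).
Proof.
have -> : cube k r = \big[setI/setT]_(i < k) (fun t => tnth t i) @^-1` `[-r, r].
  rewrite -bigcap_seq; apply/seteqP; split => t tr i.
    by move=> _ /=; rewrite in_itv /= -ler_norml.
  by have := tr i (mem_index_enum _); rewrite /= in_itv /= -ler_norml.
apply: bigsetI_measurable => i _; rewrite -[X in measurable X]setTI.
by apply: measurable_tnth => //; exact: measurable_itv.
Qed.

Lemma lebesgue_tuple_cube k r : 0 < r ->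
  lebesgue_tuple R k (cube k r) = ((r *+ 2) ^+ k)%:E.
Proof.
move=> r0; elim: k => [|k IH] /=.
  by rewrite /dirac indicE mem_set// => -[].
rewrite /leb_step /pushforward.
have -> : @cons_tup R k @^-1` cube k.+1 r = `[-r, r] `*` cube k r.
  apply/seteqP; split => -[x t] /=.
    move=> H; split => /=; first by rewrite in_itv /= -ler_norml; have := H ord0; rewrite (tnth_nth 0).
    by move=> i; have := H (lift ord0 i); rewrite !(tnth_nth 0).
  move=> [/=]; rewrite in_itv /= -ler_norml => xr tr i.
  have [j ->|->] := unliftP ord0 i; last by rewrite (tnth_nth 0).
  by have := tr j; rewrite !(tnth_nth 0).
rewrite product_measure1E//; last exact: measurable_cube.
rewrite [X in (_ * X)%E]IH [X in (X * _)%E]lebesgue_measure_itv /= lte_fin gtrN// -EFinD opprK -mulr2n.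
by rewrite -EFinM exprS.
Qed.

End Volume.

Arguments cube {R} k r.

(** * A polynomial lower bound for the volume of sublevel sets *)

Lemma differentiable0_le (K : numFieldType) (V W : normedModType K) (f : V -> W) :
  differentiable f 0 -> f 0 = 0 ->
  exists2 k : K, 0 < k & \forall x \near 0, `|f x| <= k * `|x|.
Proof.
move=> df f0.
have [k k0 dk] := linear_lipschitz (diff_continuous df).
exists (k + 1); first by rewrite addr_gt0.
have /eqaddoP/(_ 1 ltr01) o1 := diff_locally df.
near=> x.
have H : `|(f \o shift 0 - (cst (f 0) + 'd f 0)) x| <= 1 * `|x| by near: x.
rewrite !fctE /= f0 add0r addr0 in H.
by rewrite -[f x](subrK ('d f 0 x)) addrC (le_trans (ler_normD _ _))// mulrDl lerD.
Unshelve. all: end_near. Qed.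

Section SublevelVolume.
Context (R : realType) (n : nat).
Local Notation C := (Cplx R).
Implicit Types (f : 'rV[C]_n -> C).

Lemma cabs_ge0 (z : C) : 0 <= cabs z.
Proof. by case: z => a b; exact: sqrtr_ge0. Qed.

Lemma cabs_le_add (a b : R) : cabs (cplx a b) <= `|a| + `|b|.
Proof.
rewrite -[leRHS]ger0_norm ?addr_ge0// -sqrtr_sqr /cabs /=.
rewrite ler_wsqrtr// sqrrD -[a ^+ 2]real_normK ?num_real// -[b ^+ 2]real_normK ?num_real//.
by rewrite lerD2r lerDl mulrn_wge0// mulr_ge0.
Qed.

Lemma Re_le_cabs (a b : R) : `|a| <= cabs (cplx a b).
Proof. by rewrite -sqrtr_sqr ler_wsqrtr// lerDl sqr_ge0. Qed.

Lemma Im_le_cabs (a b : R) : `|b| <= cabs (cplx a b).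
Proof. by rewrite -sqrtr_sqr ler_wsqrtr// lerDr sqr_ge0. Qed.

Lemma cabs_le (x : 'rV[C]_n) (M : R) : 0 <= M ->
  (forall i, cabs (x 0 i) <= M) -> `|x| <= cofr M.
Proof.
move=> M0 xM; have [->|x0] := eqVneq (`|x|) 0; first by rewrite lecE /= eqxx.
have [[i j] xE] := mx_norm_neq0 x0; rewrite [`|x|]xE.
by rewrite /= (ord1 i) lecE /= eqxx xM.
Qed.

(** The linear bound of [differentiable0_le], with real constants and for the
    sup norm on C^n. *)
Lemma cabs_near0_le f : differentiable f 0 -> f 0 = 0 ->
  exists k rho : R, [/\ 0 < k, 0 < rho & forall (x : 'rV[C]_n) M, 0 <= M < rho ->
    (forall i, cabs (x 0 i) <= M) -> cabs (f x) <= k * M].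
Proof.
move=> df f0; have [[k kI] k0 /nbhs_normP[[rho rhoI]]] := differentiable0_le df f0.
rewrite /= ltcE /= => /andP[/eqP rhoI0 rho0] H.
move: k0; rewrite ltcE /= => /andP[/eqP kI0 k0]; subst kI rhoI.
exists k, rho; split => // x M /andP[M0 Mrho] xM.
have xM' := cabs_le M0 xM.
have : `|f x| <= cofr k * `|x|.
  apply: H; rewrite /= sub0r normrN (le_lt_trans xM')// ltcE /= eqxx//.
move/le_trans/(_ (ler_wpM2l _ xM')); rewrite lecE /= eqxx ltW// => /(_ isT).
have -> : cofr k * cofr M = cofr (k * M) :> C by rewrite /cofr /cplx; apply/esym; exact: (rmorphM (real_complex R)).
by rewrite lecE /= => /andP[].
Qed.

Lemma cube_sub_sublevel f (delta : R) : differentiable f 0 -> f 0 = 0 -> 0 < delta ->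
  exists2 kappa : R, 0 < kappa & forall e, 0 < e < 1 ->
    cube (n + n) (kappa * e) `<=`
      of_real_tuple (n := n) @^-1` [set x | euclidean_ball delta x /\ cabs (f x) < e].
Proof.
move=> df f0 delta0; have [k [rho [k0 rho0 fk]]] := cabs_near0_le df f0.
(* M bounds the moduli of the coordinates: the first term of the minimum keeps x
   in the ball of radius delta, the second one in the domain of the linear bound,
   and the third one makes k * (M * e) at most e / 2. *)
set d := delta / n.+1%:R; have d0 : 0 < d by rewrite divr_gt0.
set M := Num.min d (Num.min (rho / 2) (k *+ 2)^-1).
have M0 : 0 < M by rewrite !lt_min d0 divr_gt0// invr_gt0 mulrn_wgt0.
exists (M / 2) => [|e /andP[e0 e1] t te]; first by rewrite divr_gt0.
have tM i : cabs (of_real_tuple t 0 i) <= M * e.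
  rewrite mxE (le_trans (cabs_le_add _ _))//.
  by rewrite [M]splitr mulrDl lerD.
have MeM : M * e <= M by rewrite ger_pMr// ltW.
split => /=.
  rewrite /euclidean_ball /= /euclidean_norm2.
  rewrite (@le_lt_trans _ _ (\sum_(i < n) d ^+ 2))//.
    apply: ler_sum => i _; rewrite ler_pXn2r ?nnegrE ?cabs_ge0 ?(ltW d0)//.
    by rewrite (le_trans (tM i))// (le_trans MeM)// ge_min lexx.
  rewrite sumr_const card_ord -mulr_natl.
  have -> : delta ^+ 2 = n.+1%:R ^+ 2 * d ^+ 2 by rewrite -exprMn mulrC divfK.
  rewrite ltr_pM2r ?exprn_gt0// -natrX ltr_nat.
  by rewrite (@leq_trans n.+1)// leq_pmulr.
rewrite (@le_lt_trans _ _ (k * (M * e)))//.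
  apply: fk => //; rewrite mulr_ge0 ?(ltW M0) ?(ltW e0)//= (le_lt_trans MeM)//.
  have rho2 : rho / 2 < rho by rewrite ltr_pdivrMr// ltr_pMr// ltr1n.
  by rewrite !gt_min rho2 !orbT.
rewrite mulrA gtr_pMl//.
rewrite (@le_lt_trans _ _ (k * (k *+ 2)^-1))//.
  by rewrite ler_pM2l// !ge_min lexx !orbT.
by rewrite ltr_pdivrMr ?mulrn_wgt0// mul1r mulr2n ltrDl.
Qed.

(** This makes the volume finite, so that taking its real value loses
    nothing. *)
Lemma sublevel_sub_cube f (delta e : R) : 0 < delta ->
  of_real_tuple (n := n) @^-1` [set x | euclidean_ball delta x /\ cabs (f x) < e]
    `<=` cube (n + n) delta.
Proof.
move=> delta0 t [td _] i.
have cd j : cabs (of_real_tuple t 0 j) <= delta.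
  rewrite -(@ler_pXn2r _ 2)// ?nnegrE ?cabs_ge0 ?(ltW delta0)//.
  apply: ltW; apply: le_lt_trans td; rewrite /euclidean_norm2 (bigD1 j)//= lerDl.
  by rewrite sumr_ge0// => l _; rewrite exprn_ge0 ?cabs_ge0.
case: (split_ordP i) => j ->; have := cd j; rewrite mxE; apply: le_trans.
  exact: Re_le_cabs.
exact: Im_le_cabs.
Qed.

Lemma sublevel_volume_ge0 f (delta e : R) : 0 <= sublevel_volume f delta e.
Proof. by apply: fine_ge0; exact: measure_ge0. Qed.

Lemma sublevel_volume_ge f (delta : R) : differentiable f 0 -> f 0 = 0 -> 0 < delta ->
  exists2 kappa : R, 0 < kappa & forall e, 0 < e < 1 ->
    kappa * e ^+ (n + n) <= sublevel_volume f delta e.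
Proof.
move=> df f0 delta0; have [k k0 kf] := cube_sub_sublevel df f0 delta0.
exists ((k *+ 2) ^+ (n + n)) => [|e /[dup] /kf kfe /andP[e0 e1]].
  by rewrite exprn_gt0// mulrn_wgt0.
have := le_lebesgue_tuple kfe; rewrite lebesgue_tuple_cube ?mulr_gt0// => lo.
have := le_lebesgue_tuple (@sublevel_sub_cube f delta e delta0).
rewrite lebesgue_tuple_cube// => hi.
rewrite -lee_fin fineK; first by rewrite -exprMn mulrnAl.
rewrite ge0_fin_numE; last exact: measure_ge0.
exact: le_lt_trans hi (ltry _).
Qed.

End SublevelVolume.

(** * The spectrum *)

Section Spectrum.
Context (R : realType) (n : nat).
Local Notation C := (Cplx R).

(** A finite union of arithmetic progressions with positive steps 1 / m_i. *)
Lemma locally_finite_candidate (W : set 'rV[C]_n) (f : 'rV[C]_n -> C)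
    (X : log_resolution W f) : locally_finite_left (candidate_spectrum X).
Proof.
move=> N.
pose F (i : lr_index X) := (fun j => (lr_k i + 1 + j)%:R / (lr_m i)%:R : R) @`
  `I_(Num.bound (N * (lr_m i)%:R)).
have : finite_set (\bigcup_(i in [set: lr_index X]) F i).
  by apply: bigcup_finite => // i _; exact: finite_image.
apply: sub_finite_set => _ [[i [j [m0 ->]]] lN]; exists i => //; exists j => //=.
have jN : j%:R <= N * (lr_m i)%:R.
  apply: le_trans (_ : (lr_k i + 1 + j)%:R <= _); first by rewrite ler_nat leq_addl.
  by rewrite -ler_pdivrMr// ltr0n.
by rewrite -(ltr_nat R) (le_lt_trans jN)// archi_boundP// (le_trans _ jN).
Qed.

Lemma locally_finite_visible (W : set 'rV[C]_n) (f : 'rV[C]_n -> C)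
    (X : log_resolution W f) (Z : C -> C) :
  (forall s, is_pole Z s -> exists2 l, candidate_spectrum X l & s = cofr l) ->
  locally_finite_left (visible_spectrum Z).
Proof.
move=> ZX N; apply: sub_finite_set (locally_finite_candidate X N) => l [Ll lN].
by split=> //; have [l' Xl' [->]] := ZX _ Ll.
Qed.

Lemma visible_spectrumP (Z : C -> C) (l : R) :
  visible_spectrum Z l <-> (0 < pole_multiplicity Z l)%N.
Proof.
rewrite /pole_multiplicity /pole_order; split.
  by move=> [p Zp]; have [] := xgetPex 0%N (ex_intro _ p Zp).
by case: xgetP => // p _ Zp _; exists p.
Qed.

(** Without exponents, the expansion at N = n + 1 would contradict
    V(e) >= k e^(2 n). *)
Lemma expansion_exponent_exists (f : 'rV[C]_n -> C) (delta : R) L m c :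
  differentiable f 0 -> f 0 = 0 -> 0 < delta ->
  (forall l, L l <-> (0 < m l)%N) ->
  has_expansion (sublevel_volume f delta) L m c -> L !=set0.
Proof.
move=> df f0 delta0 mL VL; apply/set0P/negP => /eqP L0.
have [k k0 Vk] := sublevel_volume_ge df f0 delta0.
have /eqoP/(_ (k / 2)) := VL n.+1%:R; rewrite divr_gt0// => /(_ isT) Vo.
have [e /= ] : exists e : R, 0 < e < 1 /\ `|sublevel_volume f delta e -
   \sum_(l \in [set l | L l /\ l <= n.+1%:R]) expansion_term m c l e| <=
   k / 2 * `|e `^ (2 * n.+1%:R) * `|ln e| ^+ m n.+1%:R|.
  near (0 : R)^'+ => e; exists e; split; first by near: e; exact: near_right0_lt1.
  by near: e; exact: Vo.
have -> : m n.+1%:R = 0%N.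
  by apply/eqP; rewrite -leqn0 leqNgt; apply/negP => /mL; rewrite L0.
rewrite (_ : [set l | _] = set0); last first.
  by apply/seteqP; split => // l []; rewrite L0.
rewrite fsbig_set0 subr0 expr0 mulr1 => -[e01]; have /andP[e0 e1] := e01.
have := Vk _ e01 => lo /(le_trans (ler_norm _))/(le_trans lo).
rewrite ger0_norm ?powR_ge0// -natrM powR_mulrn ?(ltW e0)// leNgt => /negP; apply.
rewrite (@lt_le_trans _ _ (k * e ^+ (2 * n.+1)))//.
  by rewrite ltr_pM2r ?exprn_gt0// ltr_pdivrMr// ltr_pMr// ltr1n.
rewrite ler_pM2l// ler_wiXn2l ?(ltW e0) ?(ltW e1)//.
by rewrite mul2n -addnn leq_add.
Unshelve. all: end_near. Qed.

End Spectrum.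

Unset Implicit Arguments.

Theorem theorem3 (R : realType) (n : nat) (W : set 'rV[Cplx R]_n)
    (f : 'rV[Cplx R]_n -> Cplx R) (delta : R)
    (X : log_resolution W f) (Z : Cplx R -> Cplx R) (c : R -> R) :
  (0 < n)%N ->
  open W -> W 0 -> holomorphic W f -> f 0 = 0 ->
  0 < delta -> closed_euclidean_ball delta `<=` W ->
  is_local_zeta f delta Z ->
  (forall s, is_pole Z s -> exists2 l, candidate_spectrum X l & s = cofr l) ->
  let V := sublevel_volume f delta in
  let L := visible_spectrum Z in
  let m := pole_multiplicity Z in
  let lam := exponent L in
  let Rem := remainder V L m c in
  (forall l, L l -> c l != 0) ->
  has_expansion V L m c ->
  [/\ is_exponent L 1 (lam 1%N) /\
        (2^-1 * (ln (V e) / ln e) @[e --> 0^'+] --> lam 1%N),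
      forall k, (exists x, is_exponent L k x) ->
        2^-1 * (ln `|Rem k e| / ln e) @[e --> 0^'+] --> lam k,
      forall k, (exists x, is_exponent L k x) ->
        (0 < m (lam k))%N /\
        forall p, (0 < p)%N ->
          ((exists2 a : R, a != 0 &
              Rem k e / (e `^ (2 * lam k) * `|ln e| ^+ p.-1) @[e --> 0^'+]
                --> a)
           <-> p = m (lam k)),
      forall k, (exists x, is_exponent L k x) ->
        c (lam k) != 0 /\
        (Rem k e / (e `^ (2 * lam k) * `|ln e| ^+ (m (lam k)).-1)
           @[e --> 0^'+] --> c (lam k)) &
      forall (V' : R -> R) (L' : set R) (m' : R -> nat) (c' : R -> R),
        same_expansion V' V ->
        spectral_data L' m' c' -> has_expansion V' L' m' c' ->
        [/\ L' = L, m' =1 m & forall l, L l -> c' l = c l]].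
Proof.
move=> n0 oW W0 fW f0 delta0 _ _ ZX V L m lam Rem c0 VL.
have df : differentiable f 0 by exact: fW.
have fL : locally_finite_left L := locally_finite_visible ZX.
have mL l : L l <-> (0 < m l)%N := visible_spectrumP Z l.
have dL : spectral_data L m c by split.
have L0 : L !=set0 := expansion_exponent_exists df f0 delta0 mL VL.
have lamP k : (exists x, is_exponent L k x) -> is_exponent L k (lam k).
  exact: is_exponent_exponent.
have lamL k : (exists x, is_exponent L k x) -> L (lam k).
  by move=> /lamP[].
have Rem_cvg k : (exists x, is_exponent L k x) ->
    Rem k e / (e `^ (2 * lam k) * `|ln e| ^+ (m (lam k)).-1) @[e --> 0^'+]
      --> c (lam k).
  move=> kx; have := tail_cvg fL mL VL (lamL _ kx).
  rewrite (_ : tail V L m c (lam k) = Rem k)//; apply/funext => e.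
  by rewrite /Rem (remainderE _ _ _ _ fL (lamP _ kx)).
have exps k : (exists x, is_exponent L k x) ->
    2^-1 * (ln `|Rem k e| / ln e) @[e --> 0^'+] --> lam k.
  move=> kx; rewrite -[X in _ --> X](mulKf (_ : 2 != 0 :> R))//.
  apply: cvgM; first exact: cvg_cst.
  exact: cvg_ln_ratio (c0 _ (lamL _ kx)) (Rem_cvg _ kx).
have ex1 := is_exponent1 fL L0.
split => //.
- split; first exact: lamP.
  have VE : V = (fun e => `|Rem 1%N e|).
    apply/funext => e.
    by rewrite /Rem /remainder big_geq// subr0 ger0_norm// sublevel_volume_ge0.
  by rewrite [V]VE; exact: exps.
- move=> k kx; split; first exact/mL/lamL.
  move=> p p0; split=> [[a a0 Rema]|->]; last by exists (c (lam k)); [exact/c0/lamL|exact: Rem_cvg].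
  have mk0 : (0 < m (lam k))%N by exact/mL/lamL.
  rewrite -(prednK p0) -(prednK mk0); congr _.+1.
  exact: cvg_scale_order_unique a0 (c0 _ (lamL _ kx)) Rema (Rem_cvg _ kx).
- by move=> k kx; split; [exact/c0/lamL|exact: Rem_cvg].
move=> V' L' m' c' VV' dL' V'L'.
have LL' := expansion_unique dL dL' VL (same_expansion_has_expansion VV' V'L').
split.
- by apply/seteqP; split => l; have [[? ?] _ _] := LL' l.
- by move=> l; have [] := LL' l.
- by move=> l Ll; have [_ _ ->] := LL' l.
Qed.
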